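(* Algorithm $A$ (described in the context) approximates the optimum similarity of the maximum-similarity binary rank-1 decomposition problem within $0.828$ in time $O(nm\min\{n,m\})$. That is, on input an $n$-by-$m$ binary matrix $\mathbf{X}$, Algorithm $A$ returns binary vectors $\mathbf{a}\in\{0,1\}^n$ and $\mathbf{b}\in\{0,1\}^m$ such that $$\mathsf{sim}(\mathbf{X},\mathbf{a}\mathbf{b}^T)\;\geq\;0.828\cdot\max_{\mathbf{a}'\in\{0,1\}^n,\ \mathbf{b}'\in\{0,1\}^m}\mathsf{sim}(\mathbf{X},\mathbf{a}'\mathbf{b}'^T),$$ and it runs in time $O(nm\min\{n,m\})$.
   Context: For two binary matrices $\mathbf{X},\mathbf{Y}\in\{0,1\}^{n\times m}$, the similarity is $\mathsf{sim}(\mathbf{X},\mathbf{Y})=nm-|\mathbf{X}-\mathbf{Y}|$, where $|\cdot|$ is the number of non-zero entries; that is, $\mathsf{sim}$ counts the entries on which $\mathbf{X}$ and $\mathbf{Y}$ agree. The maximum-similarity binary rank-1 decomposition problem is: given a binary matrix $\mathbf{X}\in\{0,1\}^{n\times m}$, find $\mathbf{a}\in\{0,1\}^n$ and $\mathbf{b}\in\{0,1\}^m$ maximizing $\mathsf{sim}(\mathbf{X},\mathbf{a}\mathbf{b}^T)$, where $\mathbf{a}\mathbf{b}^T$ is the $n$-by-$m$ matrix with entries $a_ib_j$. Algorithm $A$ (deterministic). Input: an $n$-by-$m$ binary matrix $\mathbf{X}$. Output: binary vectors $\mathbf{a}$ and $\mathbf{b}$. For every row $\mathbf{x}_i$ of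 $\mathbf{X}$, let $\mathbf{b}=\mathbf{x}_i$ and find $\mathbf{a}\in\{0,1\}^n$ maximizing $\mathsf{sim}(\mathbf{X},\mathbf{a}\mathbf{b}^T)$ for this fixed $\mathbf{b}$. Among all the pairs $(\mathbf{a},\mathbf{b})$ so obtained, return the best one, i.e. one with the highest similarity.
   Formalization: When n > m the time bound is for Algorithm A run on the transpose of X (columns tried, a and b exchanged): trying all n rows as described takes at least about n² steps, exceeding O(nm min{n,m}) e.g. for m = 1. n, m ≥ 1 is assumed; the ratio is also proved for the untransposed algorithm. *)

(* Defs.v *)
From mathcomp Require Import all_boot all_order all_algebra.
From Stdlib Require Import String.

Set Implicit Arguments.
Unset Strict Implicit.
Unset Printing Implicit Defensive.

Import GRing.Theory.
Local Open Scope ring_scope.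

(* Binary matrices are matrices over [bool], which MathComp equips with its
   two-element field structure. An entry of X - Y is therefore nonzero exactly
   where X and Y differ, as it is over the integers, and a *m b^T has entries
   a_i && b_j (each sum has one term). *)

Definition nnz n m (M : 'M[bool]_(n, m)) : nat :=
  #|[pred p : 'I_n * 'I_m | M p.1 p.2 != 0]|.

Definition sim n m (X Y : 'M[bool]_(n, m)) : nat := (n * m - nnz (X - Y))%N.

Definition max_sim n m (X : 'M[bool]_(n, m)) : nat :=
  \max_(ab : 'cV[bool]_n * 'cV[bool]_m) sim X (ab.1 *m ab.2^T).

(* The pairs that Algorithm A may examine and return; ties among maximizers may
   be broken in any way. *)

Definition candidate n m (X : 'M[bool]_(n, m))
    (a : 'cV[bool]_n) (b : 'cV[bool]_m) : Prop :=
  (exists i : 'I_n, b = (row i X)^T) /\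
  (forall a' : 'cV[bool]_n, (sim X (a' *m b^T) <= sim X (a *m b^T))%N).

Definition algA_output n m (X : 'M[bool]_(n, m))
    (a : 'cV[bool]_n) (b : 'cV[bool]_m) : Prop :=
  candidate X a b /\
  (forall (a' : 'cV[bool]_n) (b' : 'cV[bool]_m),
     candidate X a' b' -> (sim X (a' *m b'^T) <= sim X (a *m b^T))%N).

(* A unit-cost random-access machine with counted loops. The store holds named
   registers and named one-dimensional arrays of naturals; the input matrix is
   read-only. [Succ] is the only arithmetic operation, so no stored number
   exceeds the input sizes plus the constants of the program plus the elapsed
   time, and charging one unit per operation hides no arithmetic on long
   numbers. *)

Inductive expr : Type :=
| Const of nat
| Reg of string
| Cell of string & expr    (* array access *)
| Input of expr & expr     (* entry of the input matrix *)
| Succ of expr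
| Eq of expr & expr        (* comparisons yield 0 or 1 *)
| Leq of expr & expr.

Inductive cmd : Type :=
| Skip
| Assign of string & expr
| Store of string & expr & expr       (* Store t i e  is  t[i] := e *)
| Seq of cmd & cmd
| If of expr & cmd & cmd
| For of string & expr & cmd.         (* For x e c: x ranges over 0 .. e - 1;
                                         e is evaluated once, on entry *)

Record store : Type := MkStore {
  regs : string -> nat;
  cells : string -> nat -> nat
}.

Definition set_reg (s : store) (x : string) (v : nat) : store :=
  MkStore (fun y => if String.eqb y x then v else regs s y) (cells s).

Definition set_cell (s : store) (t : string) (i v : nat) : store :=
  MkStore (regs s)
    (fun u k => if String.eqb u t && (k == i) then v else cells s u k).

Fixpoint eval (inp : nat -> nat -> nat) (s : store) (e : expr) : nat :=
  match e with
  | Const k => k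
  | Reg x => regs s x
  | Cell t e1 => cells s t (eval inp s e1)
  | Input e1 e2 => inp (eval inp s e1) (eval inp s e2)
  | Succ e1 => (eval inp s e1).+1
  | Eq e1 e2 => (eval inp s e1 == eval inp s e2) : nat
  | Leq e1 e2 => (eval inp s e1 <= eval inp s e2)%N : nat
  end.

Fixpoint ecost (e : expr) : nat :=
  match e with
  | Const _ | Reg _ => 1
  | Cell _ e1 | Succ e1 => (ecost e1).+1
  | Input e1 e2 | Eq e1 e2 | Leq e1 e2 => (ecost e1 + ecost e2).+1
  end.

(* Final store and elapsed time. *)
Fixpoint exec (inp : nat -> nat -> nat) (c : cmd) (s : store) : store * nat :=
  match c with
  | Skip => (s, 1%N)
  | Assign x e => (set_reg s x (eval inp s e), (ecost e).+1)
  | Store t e1 e2 =>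
      (set_cell s t (eval inp s e1) (eval inp s e2), (ecost e1 + ecost e2).+1)
  | Seq c1 c2 =>
      let r1 := exec inp c1 s in
      let r2 := exec inp c2 r1.1 in
      (r2.1, (r1.2 + r2.2)%N)
  | If e c1 c2 =>
      let r := exec inp (if eval inp s e != 0%N then c1 else c2) s in
      (r.1, (ecost e + r.2).+1)
  | For x e c1 =>
      foldl (fun (st : store * nat) (i : nat) =>
               let r := exec inp c1 (set_reg st.1 x i) in
               (r.1, (st.2 + r.2).+1))
            (s, (ecost e).+1) (iota 0 (eval inp s e))
  end.

Declare Scope prog_scope.
Delimit Scope prog_scope with prog.
Notation "c1 ;; c2" := (Seq c1 c2)
  (at level 85, right associativity, format "c1 ;;  '/' c2") : prog_scope.
Notation "x ::= e" := (Assign x e) (at level 80) : prog_scope.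

(* Algorithm A for the matrix with the given numbers of rows and columns and
   the given access to its entries. With b the i-th row fixed, the best a is
   found row by row: a_k = 1 when the k-th row agrees with b in at least as many
   places (p) as it agrees with the zero vector (q). *)
Definition search_rows (rows cols : expr) (entry : expr -> expr -> expr)
    (outa outb : string) : cmd := (
  "best" ::= Const 0 ;;
  "besti" ::= Const 0 ;;
  For "i" rows (
    "score" ::= Const 0 ;;
    For "k" rows (
      "p" ::= Const 0 ;;
      "q" ::= Const 0 ;;
      For "j" cols (
        If (Eq (entry (Reg "k") (Reg "j")) (entry (Reg "i") (Reg "j")))
           ("p" ::= Succ (Reg "p")) Skip ;;
        If (Eq (entry (Reg "k") (Reg "j")) (Const 0))
           ("q" ::= Succ (Reg "q")) Skip
      ) ;;
      If (Leq (Reg "q") (Reg "p"))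
         (Store "tmp" (Reg "k") (Const 1) ;;
          For "l" (Reg "p") ("score" ::= Succ (Reg "score")))
         (Store "tmp" (Reg "k") (Const 0) ;;
          For "l" (Reg "q") ("score" ::= Succ (Reg "score")))
    ) ;;
    If (Leq (Reg "best") (Reg "score"))
       ("best" ::= Reg "score" ;;
        "besti" ::= Reg "i" ;;
        For "k" rows (Store outa (Reg "k") (Cell "tmp" (Reg "k"))))
       Skip
  ) ;;
  For "j" cols (Store outb (Reg "j") (entry (Reg "besti") (Reg "j")))
)%prog%string.

(* The rows searched are those of X or of X^T, whichever has fewer. *)
Definition algA : cmd :=
  (If (Leq (Reg "n") (Reg "m"))
      (search_rows (Reg "n") (Reg "m") (fun e1 e2 => Input e1 e2) "a" "b")
      (search_rows (Reg "m") (Reg "n") (fun e1 e2 => Input e2 e1) "b" "a")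
  )%string.

Definition input_of n m (X : 'M[bool]_(n, m)) (i j : nat) : nat :=
  match insub i : option 'I_n, insub j : option 'I_m with
  | Some i', Some j' => X i' j'
  | _, _ => 0%N
  end.

Definition init_store (n m : nat) : store :=
  MkStore (fun x => if String.eqb x "n" then n
                    else if String.eqb x "m" then m else 0%N)
          (fun _ _ => 0%N).

Definition run n m (X : 'M[bool]_(n, m)) : store * nat :=
  exec (input_of X) algA (init_store n m).

Definition out_vec n m (X : 'M[bool]_(n, m)) (t : string) k : 'cV[bool]_k :=
  \col_i (cells (run X).1 t i != 0%N).

Definition algA_a n m (X : 'M[bool]_(n, m)) : 'cV[bool]_n := out_vec X "a" n.
Definition algA_b n m (X : 'M[bool]_(n, m)) : 'cV[bool]_m := out_vec X "b" m.
Definition algA_time n m (X : 'M[bool]_(n, m)) : nat := (run X).2.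

(* Main.v *)
(** With b ranging over the rows x_i selected by an optimal a, the average
    agreement of the selected rows in a column with p ones and q zeros is
    (p^2 + q^2) / (p + q), against at most max(p, q) for the optimum. The ratio is
    least at p / (p + q) = 1 / sqrt 2, where it equals 2 sqrt 2 - 2 > 0.828; hence
    some selected row attains this factor. On unselected rows nothing is lost,
    and if no row is selected then a = 0 is optimal for every b. *)

From Stdlib Require Import String.
Require Import Defs.
From mathcomp Require Import all_boot all_order all_algebra.
From mathcomp Require Import zify lra.
Import GRing.Theory Num.Theory.

Set Implicit Arguments.
Unset Strict Implicit.
Unset Printing Implicit Defensive.

Local Open Scope ring_scope.

(** * Similarity as a count of agreements, and transposition *)

Lemma sim_sum n m (X Y : 'M[bool]_(n, m)) :
  sim X Y = (\sum_i \sum_j (X i j == Y i j))%N.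
Proof.
(* Reading [n * m] as the number of index pairs turns the truncated subtraction into a
   complement. *)
rewrite pair_big /= /sim /nnz -{1}(card_ord n) -{1}(card_ord m) -card_prod.
rewrite -(cardC [pred p : 'I_n * 'I_m | (X - Y) p.1 p.2 != 0]) addKn -sum1_card.
rewrite big_mkcond; apply: eq_bigr => -[i j] _ /=.
by rewrite !inE !mxE /=; case: (X i j); case: (Y i j).
Qed.

Lemma sim_tr n m (X Y : 'M[bool]_(n, m)) : sim X^T Y^T = sim X Y.
Proof.
rewrite !sim_sum exchange_big; apply: eq_bigr => i _.
by apply: eq_bigr => j _; rewrite !mxE.
Qed.

Lemma sim_rank1_tr n m (X : 'M[bool]_(n, m)) (a : 'cV_n) (b : 'cV_m) :
  sim X^T (b *m a^T) = sim X (a *m b^T).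
Proof. by rewrite -[RHS]sim_tr trmx_mul trmxK. Qed.

(** Carries the ratio back from [X^T] to [X] when the columns are searched; swapping the two factors
    preserves the similarity. *)
Lemma max_sim_tr n m (X : 'M[bool]_(n, m)) : (max_sim X <= max_sim X^T)%N.
Proof.
apply/bigmax_leqP => -[a b] _ /=; rewrite -sim_rank1_tr.
exact: (leq_bigmax (b, a)).
Qed.

Local Open Scope nat_scope.

(** * The best [a] for a fixed [b] *)

Section RankOne.
Variables (n m : nat) (X : 'M[bool]_(n, m)).

Definition hits (k : 'I_n) (b : 'cV[bool]_m) := \sum_j (X k j == b j ord0).
Definition zeros (k : 'I_n) := \sum_j (X k j == false).
Definition best_sim (b : 'cV[bool]_m) := \sum_k maxn (hits k b) (zeros k).
Definition best_col (b : 'cV[bool]_m) : 'cV[bool]_n :=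
  (\col_k (zeros k <= hits k b)%N)%R.

(** Row [k] of the product is [b] or zero according to [a k ord0], so each row can be optimised
    separately. *)
Lemma sim_rank1 (a : 'cV[bool]_n) (b : 'cV[bool]_m) :
  sim X (a *m b^T)%R = \sum_k (if a k ord0 then hits k b else zeros k).
Proof.
rewrite sim_sum; apply: eq_bigr => k _; rewrite /hits /zeros.
have E j : (a *m b^T)%R k j = a k ord0 && b j ord0.
  by rewrite mxE big_ord1 mxE.
by case: ifP => ak; apply: eq_bigr => j _; rewrite E ak.
Qed.

Lemma sim_le_best a b : sim X (a *m b^T)%R <= best_sim b.
Proof.
rewrite sim_rank1; apply: leq_sum => k _.
by case: ifP; rewrite ?leq_maxl ?leq_maxr.
Qed.

Lemma sim_best_col b : sim X (best_col b *m b^T)%R = best_sim b.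
Proof.
rewrite sim_rank1; apply: eq_bigr => k _; rewrite mxE.
by case: leqP => H; lia.
Qed.

Lemma candidateP a b :
  candidate X a b <->
  (exists i, b = (row i X)^T%R) /\ sim X (a *m b^T)%R = best_sim b.
Proof.
split=> [[Hb Ha]|[Hb Ha]]; split=> //.
  by apply/eqP; rewrite eqn_leq sim_le_best -sim_best_col Ha.
by move=> a'; rewrite Ha sim_le_best.
Qed.

Lemma algA_outputP a i0 : let b := (row i0 X)^T%R in
  sim X (a *m b^T)%R = best_sim b ->
  (forall i, best_sim (row i X)^T%R <= best_sim b) -> algA_output X a b.
Proof.
move=> b Hab Hmax; split; first by apply/candidateP; split=> //; exists i0.
by move=> a' b' /candidateP[[i ->] ->]; rewrite Hab.
Qed.

Lemma algA_output_exists : 0 < n -> exists a b, algA_output X a b.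
Proof.
move=> n0; pose F i := best_sim (row i X)^T%R.
pose i0 := [arg max_(i > Ordinal n0) F i].
exists (best_col (row i0 X)^T%R), (row i0 X)^T%R.
apply: algA_outputP; first exact: sim_best_col.
by move=> i; rewrite -!/(F _) /i0; case: arg_maxnP => // j _; apply.
Qed.

Lemma algA_output_ge a b i :
  algA_output X a b -> best_sim (row i X)^T%R <= sim X (a *m b^T)%R.
Proof.
case=> _ H; rewrite -sim_best_col; apply: H; apply/candidateP.
by split; [exists i | exact: sim_best_col].
Qed.

(** * The approximation ratio *)

Lemma agreement_ratio p q :
  828 * (p + q) * maxn p q <= 1000 * (p * p + q * q).
Proof.
have key x y : 828 * (x + y) * x <= 1000 * (x * x + y * y).
  (* 172 (172 x^2 - 828 x y + 1000 y^2) = (172 x - 414 y)^2 + 604 y^2 *)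
  have [] := nat_Cauchy (172 * x) (414 * y); rewrite !expnS !expn0 !muln1 => H _.
  by rewrite -(leq_pmul2l (isT : 0 < 172)); nia.
case: (leqP p q) => _; last exact: key.
rewrite addnC (addnC (p * p)); exact: key.
Qed.

(** A row with value [v] in column [j] agrees there with [h v] rows of [A]. Summing over [A] gives
    the two squares of [agreement_ratio], and the count for [c] is at most the larger of the two. *)
Lemma column_agreement (A : {set 'I_n}) (j : 'I_m) (c : bool) :
  828 * #|A| * \sum_(k in A) (X k j == c)
    <= 1000 * \sum_(i in A) \sum_(k in A) (X k j == X i j).
Proof.
pose h c := \sum_(k in A) (X k j == c).
have hA : #|A| = h true + h false.
  rewrite -sum1_card /h -big_split /=; apply: eq_bigr => k _.
  by case: (X k j).
have -> : \sum_(i in A) \sum_(k in A) (X k j == X i j)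
          = h true * h true + h false * h false.
  rewrite {1 3}/h !big_distrl -big_split /=; apply: eq_bigr => i _.
  by case: (X i j); rewrite -/(h _); lia.
rewrite hA -/(h c); apply: leq_trans (agreement_ratio _ _).
by rewrite leq_mul2l; case: c; rewrite ?leq_maxl ?leq_maxr orbT.
Qed.

(** Averaging over the rows selected by an optimal [a], multiplied out by their number to avoid
    division. *)
Lemma best_row_ratio (S : nat) : 0 < n ->
  (forall i, best_sim (row i X)^T%R <= S) -> 828 * max_sim X <= 1000 * S.
Proof.
move=> n0 HS.
have I0 : 0 < #|{: 'cV[bool]_n * 'cV[bool]_m}|.
  by apply/card_gt0P; exists (0%R, 0%R).
rewrite /max_sim; have [[a b] ->] := eq_bigmax (fun ab => sim X (ab.1 *m ab.2^T)%R) I0.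
rewrite /= sim_rank1; pose A := [set k | a k ord0].
(* Unselected rows contribute [Z] to the optimum and at least [Z] to every [best_sim]. *)
pose Z := \sum_(k | k \notin A) zeros k.
have -> : \sum_k (if a k ord0 then hits k b else zeros k)
          = \sum_(k in A) hits k b + Z.
  rewrite (bigID [in A]) /=; congr (_ + _); apply: eq_bigr => k;
  by rewrite inE; move=> kA; rewrite ?kA ?(negPf kA).
(* With no row selected the optimum is [Z], which any row of [X] reaches; [n0] supplies one. *)
have [A0|Apos] := posnP #|A|.
  rewrite big_pred0 => [|k]; last by rewrite (cards0_eq A0) inE.
  have: Z <= S.
    apply: leq_trans (HS (Ordinal n0)).
    rewrite /Z big_mkcond; apply: leq_sum => k _.
    by case: ifP => // _; exact: leq_maxr.
  by lia.
rewrite -(leq_pmul2l Apos).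
(* In each maximum of [best_sim], keep [hits] on [A] and [zeros] outside it. *)
have lower : \sum_(i in A) \sum_(k in A) hits k (row i X)^T%R + #|A| * Z
             <= #|A| * S.
  rewrite -!sum_nat_const -big_split /=; apply: leq_sum => i _.
  apply: leq_trans (HS i); rewrite [leqRHS](bigID [in A]) /=.
  by apply: leq_add; apply: leq_sum => k _; rewrite ?leq_maxl ?leq_maxr.
suff: 828 * #|A| * \sum_(k in A) hits k b
      <= 1000 * \sum_(i in A) \sum_(k in A) hits k (row i X)^T%R by nia.
(* The column sums move outermost on both sides, so that columns can be compared one by one. *)
rewrite [X in _ * X <= _]exchange_big big_distrr /=.
under [X in _ <= _ * X]eq_bigr do rewrite exchange_big.
rewrite [X in _ <= _ * X]exchange_big big_distrr /=; apply: leq_sum => j _.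
apply: leq_trans (column_agreement A j (b j ord0)) _.
rewrite leq_mul2l /=; apply: leq_sum => i _; apply: leq_sum => k _.
by rewrite !mxE.
Qed.

Lemma algA_output_ratio a b : 0 < n -> algA_output X a b ->
  ((828%:R / 1000%:R : rat) * (max_sim X)%:R <= (sim X (a *m b^T))%:R)%R.
Proof.
move=> n0 Hab; have := best_row_ratio n0 (fun i => algA_output_ge i Hab).
by rewrite -(ler_nat rat) !natrM; lra.
Qed.

End RankOne.

(** * Program logic with running time *)

Section Programs.
Variable inp : nat -> nat -> nat.

(** The postcondition also receives the elapsed time, so correctness and cost are proved in one
    pass. *)
Definition wp (c : cmd) (s : store) (Q : store -> nat -> Prop) : Prop :=
  Q (exec inp c s).1 (exec inp c s).2.

Lemma wp_seq c1 c2 s Q :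
  wp c1 s (fun s1 t1 => wp c2 s1 (fun s2 t2 => Q s2 (t1 + t2))) ->
  wp (Seq c1 c2) s Q.
Proof. by []. Qed.

Lemma wp_skip s (Q : store -> nat -> Prop) : Q s 1 -> wp Skip s Q.
Proof. by []. Qed.

Lemma wp_assign x e s (Q : store -> nat -> Prop) :
  Q (set_reg s x (eval inp s e)) (ecost e).+1 -> wp (Assign x e) s Q.
Proof. by []. Qed.

Lemma wp_store u e1 e2 s (Q : store -> nat -> Prop) :
  Q (set_cell s u (eval inp s e1) (eval inp s e2)) (ecost e1 + ecost e2).+1 ->
  wp (Store u e1 e2) s Q.
Proof. by []. Qed.

Lemma wp_if e c1 c2 s (Q : store -> nat -> Prop) :
  wp (if eval inp s e != 0 then c1 else c2) s (fun s' t => Q s' (ecost e + t).+1) ->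
  wp (If e c1 c2) s Q.
Proof. by []. Qed.

(** Induction on prefixes of the index list. The invariant describes the store before the loop
    register is set; each pass costs at most [T] plus one unit of overhead. *)
Lemma wp_for (I : nat -> store -> Prop) N T x e c s (Q : store -> nat -> Prop) :
  eval inp s e = N -> I 0 s ->
  (forall i s', i < N -> I i s' ->
     wp c (set_reg s' x i) (fun s'' t => I i.+1 s'' /\ t <= T)) ->
  (forall s' t, I N s' -> t <= (ecost e).+1 + N * T.+1 -> Q s' t) ->
  wp (For x e c) s Q.
Proof.
move=> eN I0 Istep QI; rewrite /wp /= eN.
set F := fun st i => _; suff: forall k, k <= N ->
    let r := foldl F (s, (ecost e).+1) (iota 0 k) in
    I k r.1 /\ r.2 <= (ecost e).+1 + k * T.+1.
  by case/(_ N (leqnn N)) => /QI; apply.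
elim=> [_|k IH kN]; first by rewrite /= addn0.
have [Ik tk] := IH (ltnW kN).
rewrite -[in iota _ _]addn1 iotaD foldl_cat /= add0n.
have [I1 t1] := Istep _ _ kN Ik; split=> //.
by move: tk t1; rewrite mulSn; lia.
Qed.

(** [xs] lists the registers that may change. Boolean membership lets side conditions on concrete
    names be settled by computation. *)
Definition frame (xs : seq string) (s s' : store) : Prop :=
  forall x, ~~ has (String.eqb x) xs -> regs s' x = regs s x.

Lemma frame_trans xs s1 s2 s3 : frame xs s1 s2 -> frame xs s2 s3 -> frame xs s1 s3.
Proof. by move=> H1 H2 x Hx; rewrite H2 ?H1. Qed.

Lemma frame_sub ys xs s s' :
  (forall x, has (String.eqb x) ys -> has (String.eqb x) xs) ->
  frame ys s s' -> frame xs s s'.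
Proof. by move=> sub H x Hx; apply: H; apply: contra Hx; apply: sub. Qed.

Lemma frame_set_reg xs s s' x v :
  has (String.eqb x) xs -> frame xs s s' -> frame xs s (set_reg s' x v).
Proof.
move=> xxs H y Hy /=; case E: (String.eqb y x); last exact: H.
by move/String.eqb_eq: E Hy => ->; rewrite xxs.
Qed.

(** Addition by repeated [Succ]: each increment costs 3, plus 1 for the loop, so the cost is linear
    in the value added. *)
Lemma wp_add_score x s (Q : store -> nat -> Prop) :
  (forall s' t, frame [:: "l"; "score"]%string s s' -> cells s' = cells s ->
     regs s' "score"%string = regs s "score"%string + regs s x ->
     t <= 2 + regs s x * 4 -> Q s' t) ->
  wp (For "l" (Reg x) (Assign "score" (Succ (Reg "score"))))%string s Q.
Proof.
move=> HQ; apply: (wp_for (N := regs s x) (T := 3) (I := fun i s' =>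
  [/\ frame [:: "l"; "score"]%string s s', cells s' = cells s &
      regs s' "score"%string = regs s "score"%string + i])) => //.
- by split; rewrite ?addn0.
- move=> i s' _ [F C S]; apply: wp_assign; split=> //; split=> //=.
    by do 2![apply: frame_set_reg => //].
  by rewrite S addnS.
- by move=> s' t [F C S]; apply: HQ.
Qed.

Lemma cells_set_cell_ne s u u' i v :
  String.eqb u' u = false -> cells (set_cell s u i v) u' = cells s u'.
Proof. by move=> /= ->. Qed.

(** * Correctness and cost of the row search *)

Section Search.
(** [M] is the matrix as the search sees it: the input or its transpose. [n] and [m] stay the
    dimensions of the input. *)
Variables (r c : nat) (M : nat -> nat -> nat) (n m : nat).
Variables (rows cols : expr) (entry : expr -> expr -> expr) (outa outb : string).

Definition dims (s : store) := regs s "n"%string = n /\ regs s "m"%string = m.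

Hypothesis rowsE : forall s, dims s -> eval inp s rows = r.
Hypothesis colsE : forall s, dims s -> eval inp s cols = c.
Hypothesis rows_cost : ecost rows = 1.
Hypothesis cols_cost : ecost cols = 1.
Hypothesis entryE : forall s e1 e2,
  eval inp s (entry e1 e2) = M (eval inp s e1) (eval inp s e2).
Hypothesis entry_cost : forall e1 e2,
  ecost (entry e1 e2) = (ecost e1 + ecost e2).+1.
Hypothesis tmp_outa : String.eqb "tmp" outa = false.
Hypothesis outa_outb : String.eqb outa outb = false.

(** The bound [w] makes these partial sums serve as loop invariants; at full width they become
    [hits], [zeros] and [best_sim]. *)
Definition matches i k w := \sum_(j < w) (M k j == M i j).
Definition blanks k w := \sum_(j < w) (M k j == 0).
Definition score i w := \sum_(k < w) maxn (matches i k c) (blanks k c).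

Lemma frame_dims xs s s' :
  ~~ has (String.eqb "n") xs -> ~~ has (String.eqb "m") xs ->
  frame xs s s' -> dims s -> dims s'.
Proof. by move=> Hn Hm F [dn dm]; split; rewrite F. Qed.

Definition count_loop : cmd := (
  For "j" cols (
    If (Eq (entry (Reg "k") (Reg "j")) (entry (Reg "i") (Reg "j")))
       (Assign "p" (Succ (Reg "p"))) Skip ;;
    If (Eq (entry (Reg "k") (Reg "j")) (Const 0))
       (Assign "q" (Succ (Reg "q"))) Skip)
  )%prog%string.

Lemma wp_count i k s (Q : store -> nat -> Prop) : dims s ->
  regs s "i"%string = i -> regs s "k"%string = k ->
  regs s "p"%string = 0 -> regs s "q"%string = 0 ->
  (forall s' t, frame [:: "j"; "p"; "q"]%string s s' -> cells s' = cells s ->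
     regs s' "p"%string = matches i k c -> regs s' "q"%string = blanks k c ->
     t <= 2 + c * 21 -> Q s' t) ->
  wp count_loop s Q.
Proof.
move=> ds si sk sp sq HQ.
(* The two conditionals of the body cost at most 11 and 9, hence 20. *)
apply: (wp_for (N := c) (T := 20) (I := fun w s' =>
  [/\ frame [:: "j"; "p"; "q"]%string s s', cells s' = cells s,
      regs s' "p"%string = matches i k w & regs s' "q"%string = blanks k w])).
- exact: colsE.
- by split; rewrite /matches /blanks ?big_ord0.
- move=> j s' _ [F C P B].
  have s'i : regs s' "i"%string = i by rewrite F.
  have s'k : regs s' "k"%string = k by rewrite F.
  apply: wp_seq; apply: wp_if.
  rewrite [eval _ _ _]/= !entryE /= s'i s'k !entry_cost eqb0 negbK.
  rewrite /matches /blanks !big_ord_recr /= -/(matches i k j) -/(blanks k j).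
  case: eqP => _ /=; [apply: wp_assign | apply: wp_skip];
    apply: wp_if; rewrite [eval _ _ _]/= !entryE /= s'k !entry_cost eqb0 negbK;
    case: eqP => _ /=; rewrite /wp /= P B ?addn0 ?addn1; split=> //; split=> //;
    by repeat apply: frame_set_reg.
- by move=> s' t [F C P B]; rewrite cols_cost => Ht; apply: HQ.
Qed.

Definition score_loop : cmd := (
  For "k" rows (
    Assign "p" (Const 0) ;;
    Assign "q" (Const 0) ;;
    count_loop ;;
    If (Leq (Reg "q") (Reg "p"))
       (Store "tmp" (Reg "k") (Const 1) ;;
        For "l" (Reg "p") (Assign "score" (Succ (Reg "score"))))
       (Store "tmp" (Reg "k") (Const 0) ;;
        For "l" (Reg "q") (Assign "score" (Succ (Reg "score")))))
  )%prog%string.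

Definition score_regs := [:: "k"; "p"; "q"; "j"; "l"; "score"]%string.

Lemma leq_matches i k w : matches i k w <= w.
Proof.
rewrite -[leqRHS]card_ord -sum1_card; apply: leq_sum => j _; exact: leq_b1.
Qed.

Lemma leq_blanks k w : blanks k w <= w.
Proof.
rewrite -[leqRHS]card_ord -sum1_card; apply: leq_sum => j _; exact: leq_b1.
Qed.

Lemma wp_score i s (Q : store -> nat -> Prop) : dims s ->
  regs s "i"%string = i -> regs s "score"%string = 0 ->
  (forall s' t, frame score_regs s s' ->
     (forall u, String.eqb u "tmp" = false -> cells s' u = cells s u) ->
     regs s' "score"%string = score i r ->
     (forall k, k < r ->
        cells s' "tmp"%string k = (blanks k c <= matches i k c)) ->
     t <= 2 + r * (16 + c * 25) -> Q s' t) ->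
  wp score_loop s Q.
Proof.
move=> ds si ss HQ.
(* Counting takes [2 + 21 * c] and the addition at most [2 + 4 * c], since both counts are at most
   [c]; the remaining 11 units are the assignments, the test and the array write. *)
apply: (wp_for (N := r) (T := 15 + c * 25) (I := fun w s' =>
  [/\ frame score_regs s s',
      forall u, String.eqb u "tmp" = false -> cells s' u = cells s u,
      regs s' "score"%string = score i w &
      forall k, k < w ->
        cells s' "tmp"%string k = (blanks k c <= matches i k c)])).
- exact: rowsE.
- by split=> //; rewrite /score big_ord0.
- move=> k s1 _ [F1 C1 S1 T1].
  do 2![apply: wp_seq; apply: wp_assign]; apply: wp_seq.
  set s2 := set_reg _ "q" _.
  have F2 : frame score_regs s s2 by repeat apply: frame_set_reg.
  apply: (@wp_count i k) => //.
  + exact: frame_dims F2 ds.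
  + by rewrite F2.
  move=> s3 t3 F3 C3 P3 B3 Ht3.
  have S3 : regs s3 "score"%string = score i k by rewrite F3.
  have K3 : regs s3 "k"%string = k by rewrite F3.
  have {}F3 : frame score_regs s s3.
    apply: (frame_trans F2); apply: frame_sub F3 => x /=.
    by do 3!case: String.eqb => //; rewrite ?orbT.
  have {}C3 : cells s3 = cells s1 by rewrite C3.
  apply: wp_if; rewrite [eval _ _ _]/= P3 B3 eqb0 negbK.
  case: (leqP (blanks k c) (matches i k c)) => Hbm;
    apply: wp_seq; apply: wp_store; apply: wp_add_score => s4 t4 F4 C4 S4 Ht4;
    move: S4 Ht4; rewrite /= ?P3 ?B3 S3 => S4 Ht4; split.
  + split.
    * apply: (frame_trans F3); apply: frame_sub F4 => x /=.
      by do 2!case: String.eqb => //; rewrite ?orbT.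
    * by move=> u ut; rewrite C4 /= ut /= C3 C1.
    * by rewrite S4 /score big_ord_recr /= (maxn_idPl _).
    * move=> k'; rewrite ltnS C4 /= K3 C3.
      by case: eqP => [->|] //= ?; [rewrite Hbm | move=> ?; apply: T1; lia].
  + by have := leq_matches i k c; move: Ht3 Ht4 => /=; lia.
  + split.
    * apply: (frame_trans F3); apply: frame_sub F4 => x /=.
      by do 2!case: String.eqb => //; rewrite ?orbT.
    * by move=> u ut; rewrite C4 /= ut /= C3 C1.
    * by rewrite S4 /score big_ord_recr /= (maxn_idPr (ltnW _)).
    * move=> k'; rewrite ltnS C4 /= K3 C3.
      by case: eqP => [->|] //= ?; [rewrite leqNgt Hbm | move=> ?; apply: T1; lia].
  + by have := leq_blanks k c; move: Ht3 Ht4 => /=; lia.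
- by move=> s' t [F C P B]; rewrite rows_cost => Ht; apply: HQ.
Qed.

Lemma wp_search s (Q : store -> nat -> Prop) : 0 < r -> 0 < c -> dims s ->
  (forall s' t i, i < r -> (forall i', i' < r -> score i' r <= score i r) ->
     (forall k, k < r -> cells s' outa k = (blanks k c <= matches i k c)) ->
     (forall j, j < c -> cells s' outb j = M i j) ->
     t <= 100 * (r * c * r) -> Q s' t) ->
  wp (search_rows rows cols entry outa outb) s Q.
Proof.
move=> r0 c0 ds HQ.
(* Lower-order costs are absorbed into [r * c], which needs both dimensions positive. *)
have r_rc : r <= r * c by rewrite leq_pmulr.
have c_rc : c <= r * c by rewrite leq_pmull.
apply: wp_seq; apply: wp_assign; apply: wp_seq; apply: wp_assign; apply: wp_seq.
(* The left disjunct is the state before any row is recorded. Since the test is [best <= score], the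
   first row always passes it, so the outputs are genuinely written; later ties overwrite. *)
apply: (wp_for (N := r) (T := 60 * (r * c)) (I := fun w s' => dims s' /\
  ((w = 0 /\ regs s' "best"%string = 0) \/
   exists i, [/\ i < r, regs s' "besti"%string = i,
     regs s' "best"%string = score i r,
     forall i', i' < w -> score i' r <= score i r &
     forall k, k < r -> cells s' outa k = (blanks k c <= matches i k c)]))).
- exact: rowsE.
- by split=> //; left.
- move=> i s1 ir [d1 best1].
  apply: wp_seq; apply: wp_assign; apply: wp_seq; apply: (@wp_score i) => //.
  move=> s2 t2 F2 C2 S2 T2 Ht2.
  have d2 : dims s2 by apply: frame_dims F2 _.
  have C2a : cells s2 outa = cells s1 outa by rewrite C2 // String.eqb_sym.
  apply: wp_if; rewrite [eval _ _ _]/= S2 [regs s2 "best"%string]F2 // eqb0 negbK.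
  case: leqP => Hbest.
    apply: wp_seq; apply: wp_assign; apply: wp_seq; apply: wp_assign.
    set s3 := set_reg _ "besti" _.
    apply: (wp_for (N := r) (T := 4) (I := fun w s' =>
      [/\ frame [:: "k"]%string s3 s', cells s' "tmp"%string = cells s2 "tmp"%string &
        forall k, k < w -> cells s' outa k = cells s2 "tmp"%string k])).
    + exact: rowsE.
    + by [].
    + move=> k s4 kr [F4 T4 A4]; apply: wp_store; split=> //; split.
      * exact: (@frame_set_reg [:: "k"%string] s3 s4 "k"%string k isT F4).
      * by rewrite cells_set_cell_ne.
      * move=> k'; rewrite /= ltnS String.eqb_refl T4 /=.
        by case: eqP => [->|] //= ? ?; apply: A4; lia.
    move=> s4 t4 [F4 _ A4]; rewrite rows_cost => Ht4; split; last first.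
      by move: Ht2 Ht4 => /=; lia.
    split; first by apply: frame_dims F4 _.
    right; exists i; split=> //.
    + by rewrite F4 //= F2.
    + by rewrite F4 //= S2.
    + move=> i'; rewrite ltnS leq_eqVlt => /predU1P[-> //|i'i].
      case: best1 => [[i0]|[i1 [_ _ b1 max1 _]]]; first by rewrite i0 in i'i.
      by apply: leq_trans (max1 _ i'i) _; move: Hbest; rewrite /= b1.
    + by move=> k kr; rewrite A4 // T2.
  apply: wp_skip; split; last by move: Ht2 => /=; lia.
  split=> //; right; case: best1 => [[_ b1]|[i1 [i1r bi1 b1 max1 A1]]].
    by move: Hbest; rewrite /= b1.
  exists i1; split=> //; rewrite ?C2a // ?F2 //.
  move=> i'; rewrite ltnS leq_eqVlt => /predU1P[->|]; last exact: max1.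
  by apply: ltnW; move: Hbest; rewrite /= b1.
- move=> s1 t1 [d1 [[r_eq0]|[i [ir bi _ maxi A1]]]]; first by rewrite r_eq0 in r0.
  rewrite rows_cost => Ht1.
  (* Writing [outb] must leave [outa] intact, which holds because the two names differ. *)
  apply: (wp_for (N := c) (T := 5) (I := fun w s' =>
    [/\ frame [:: "j"]%string s1 s', cells s' outa = cells s1 outa &
      forall j, j < w -> cells s' outb j = M i j])).
  + exact: colsE.
  + by [].
  + move=> j s2 jc [F2 A2 B2]; apply: wp_store; split; last by rewrite entry_cost.
    split.
    * exact: (@frame_set_reg [:: "j"%string] s1 s2 "j"%string j isT F2).
    * by rewrite cells_set_cell_ne.
    * move=> j'; rewrite /= ltnS String.eqb_refl entryE /= F2 // bi.
      by case: eqP => [->|] //= ? ?; apply: B2; lia.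
  move=> s2 t2 [F2 A2 B2]; rewrite cols_cost => Ht2.
  apply: (HQ _ _ i) => //; first by move=> k kr; rewrite A2 A1.
  by have := leq_pmulr (r * c) r0; move: Ht1 Ht2 => /=; lia.
Qed.

End Search.
End Programs.

(** * From machine arrays to Algorithm A *)

(** On ordinals the counts of the program are those of the matrix, and ties give [a_k = 1] in both,
    so the arrays decode to [best_col] of a best row and that row itself. *)
Lemma search_output r c (X : 'M[bool]_(r, c)) (M : nat -> nat -> nat)
    (fa fb : nat -> nat) i :
  (forall (k : 'I_r) (j : 'I_c), M k j = X k j) -> i < r ->
  (forall i', i' < r -> score c M i' r <= score c M i r) ->
  (forall k, k < r -> fa k = (blanks M k c <= matches M i k c)) ->
  (forall j, j < c -> fb j = M i j) ->
  algA_output X (\col_k (fa k != 0))%R (\col_j (fb j != 0))%R.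
Proof.
move=> MX ir maxi faE fbE; pose b i := (row i X)^T%R.
have matchesE (i' k : 'I_r) : matches M i' k c = hits X k (b i').
  by apply: eq_bigr => j _; rewrite !MX !mxE; case: (X k j); case: (X i' j).
have blanksE (k : 'I_r) : blanks M k c = zeros X k.
  by apply: eq_bigr => j _; rewrite MX; case: (X k j).
have scoreE (i' : 'I_r) : score c M i' r = best_sim X (b i').
  by apply: eq_bigr => k _; rewrite matchesE blanksE.
pose i0 := Ordinal ir.
have -> : (\col_j (fb j != 0))%R = b i0.
  apply/matrixP => j l; rewrite !mxE fbE // -[i]/(val i0) MX.
  by case: (X i0 j).
apply: algA_outputP => [|i']; last by rewrite -!scoreE; exact: maxi.
suff -> : (\col_k (fa k != 0))%R = best_col X (b i0) by exact: sim_best_col.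
apply/matrixP => k l; rewrite !mxE faE // -[i]/(val i0) matchesE blanksE.
by case: (_ <= _).
Qed.

Lemma input_ofE n m (X : 'M[bool]_(n, m)) (i : 'I_n) (j : 'I_m) :
  input_of X i j = X i j.
Proof. by rewrite /input_of !valK. Qed.

Lemma algA_run n m (X : 'M[bool]_(n, m)) : 0 < n -> 0 < m ->
  (if n <= m then algA_output X (algA_a X) (algA_b X)
   else algA_output X^T%R (algA_b X) (algA_a X)) /\
  algA_time X <= 104 * (n * m * minn n m).
Proof.
move=> n0 m0; rewrite /algA_a /algA_b /algA_time /out_vec.
suff: wp (input_of X) algA (init_store n m) (fun s t =>
  (if n <= m then
     algA_output X (\col_k (cells s "a" k != 0))%R (\col_j (cells s "b" j != 0))%R
   else
     algA_output X^T%R (\col_j (cells s "b" j != 0))%R (\col_k (cells s "a" k != 0))%R)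
  /\ t <= 104 * (n * m * minn n m))%string by [].
apply: wp_if; rewrite [eval _ _ _]/= eqb0 negbK /=.
(* The outer test adds 4 units to the bound with factor 100; positivity absorbs them into 104. The
   searched dimension is the smaller one, so [r * c * r] is the claimed product. *)
have nm0 : 0 < n * m by rewrite muln_gt0 n0.
case: (leqP n m) => nm.
  apply: (@wp_search _ n m (input_of X) n m) => //; try by move=> s [].
  move=> s t i ir maxi aE bE Ht; split; last first.
    by have := leq_pmulr (n * m) n0; move: Ht; lia.
  exact: search_output (input_ofE X) ir maxi aE bE.
apply: (@wp_search _ m n (fun i j => input_of X j i) n m) => //;
  try by [move=> s [] | move=> e1 e2 /=; rewrite addnC].
move=> s t i ir maxi bE aE Ht; split; last first.
  by have := leq_pmulr (n * m) m0; move: Ht; rewrite (mulnC m n); lia.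
apply: search_output ir maxi bE aE => k j; by rewrite input_ofE mxE.
Qed.

Local Close Scope nat_scope.

(** The first clause covers every tie-breaking, the other two the concrete program. With [n = 0]
    there is no candidate, and on an empty matrix the time bound would be 0. *)
Theorem lemma3 :
  (forall (n m : nat) (X : 'M[bool]_(n, m)), (0 < n)%N ->
     (exists (a : 'cV[bool]_n) (b : 'cV[bool]_m), algA_output X a b) /\
     (forall (a : 'cV[bool]_n) (b : 'cV[bool]_m), algA_output X a b ->
        (828%:R / 1000%:R : rat) * (max_sim X)%:R <= (sim X (a *m b^T))%:R)) /\
  (forall (n m : nat) (X : 'M[bool]_(n, m)), (0 < n)%N -> (0 < m)%N ->
     (if (n <= m)%N then algA_output X (algA_a X) (algA_b X)
      else algA_output X^T (algA_b X) (algA_a X)) /\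
     (828%:R / 1000%:R : rat) * (max_sim X)%:R <= (sim X (algA_a X *m (algA_b X)^T))%:R) /\
  (exists C : nat, forall (n m : nat) (X : 'M[bool]_(n, m)),
     (0 < n)%N -> (0 < m)%N ->
     (algA_time X <= C * (n * m * minn n m))%N).
Proof.
split; last split.
- move=> n m X n0; split; first exact: algA_output_exists.
  by move=> a b; exact: algA_output_ratio.
- move=> n m X n0 m0; have [out _] := algA_run X n0 m0.
  split; first exact: out.
  case: ifP out => _ out; first exact: algA_output_ratio out.
  (* The ratio holds for [X^T]; transposition keeps the similarity and does not lower the
     optimum. *)
  have := algA_output_ratio m0 out.
  rewrite (sim_rank1_tr X (algA_a X) (algA_b X)).
  by have := max_sim_tr X; rewrite -(ler_nat rat); lra.
- exists 104%N => n m X n0 m0; exact: (algA_run X n0 m0).2.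
Qed.
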